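(* Let $1\leq\rho\leq2$. As $\varepsilon\to0$ (with $\varepsilon\ge 0$), $$\psi_\rho(1+\varepsilon)\leq 1+\sqrt[4]{8(\rho-1)\varepsilon}+O(\varepsilon^{1/2}).$$ That is, for each such $\rho$ there exist constants $C>0$ and $\varepsilon_0>0$ such that $\psi_\rho(1+\varepsilon)\le 1+(8(\rho-1)\varepsilon)^{1/4}+C\varepsilon^{1/2}$ for all $0\le\varepsilon\le\varepsilon_0$.
   Context: For a complex Hilbert space $H$, $\mathcal{B}(H)$ denotes the algebra of bounded linear operators on $H$, with operator norm $\|\cdot\|$. For real $\rho\ge 1$, the class $\mathcal{C}_\rho$ consists of the operators $T\in\mathcal{B}(H)$ admitting a unitary $\rho$-dilation: there exist a Hilbert space $\mathcal{H}\supset H$ (containing $H$ as a closed subspace) and a unitary operator $U\in\mathcal{B}(\mathcal{H})$ such that $T^n=\rho\, P U^n P^*$ for all $n=1,2,\dots$, where $P:\mathcal{H}\to H$ is the orthogonal projection from $\mathcal{H}$ onto $H$ (so $P^*:H\to\mathcal{H}$ is the inclusion). The operator $\rho$-radius is $$w_\rho(A)=\inf\{\lambda>0 : \lambda^{-1}A\in\mathcal{C}_\rho\}.$$ For real $r\ge1$, define $$\psi_\rho(r)=\sup\{\|A\| : A\in\mathcal{B}(H),\ A\text{ invertible},\ w_\rho(A)\leq r,\ w_\rho(A^{-1})\leq r\},$$ where the supremum is also taken over all complex Hilbert spaces $H$. *)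

(* Defs.v *)
From HB Require Import structures.
From mathcomp Require Import all_boot all_order all_algebra.
From mathcomp Require Import complex.
From mathcomp Require Import all_classical all_reals all_analysis.

Set Implicit Arguments.
Unset Strict Implicit.
Unset Printing Implicit Defensive.

Import Order.TTheory GRing.Theory Num.Theory.
Import numFieldNormedType.Exports.

Local Open Scope classical_set_scope.
Local Open Scope ring_scope.
Local Open Scope complex_scope.

(* The inner product is linear in its first argument and conjugate-linear in
   the second one. *)
HB.mixin Record CompleteNormedModule_isHilbert (R : realType) H
    of CompleteNormedModule R[i] H := {
  inner : {dot H for (@Num.conj R[i])} ;
  normr_inner : forall x : H, `|x| ^+ 2 = inner x x }.

#[short(type="hilbertType")]
HB.structure Definition Hilbert (R : realType) :=
  {H of CompleteNormedModule R[i] H & CompleteNormedModule_isHilbert R H}.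

Section Operators.
Context {R : realType}.

Definition bounded_operator (H K : hilbertType R) (A : {linear H -> K}) :=
  bounded_near A (nbhs (0 : H)).

(* The norm of [H] takes its values in [R[i]], where they are real. *)
Definition opnorm (H K : hilbertType R) (A : {linear H -> K}) : \bar R :=
  ereal_sup [set (complex.Re `|A x|)%:E | x in [set x : H | `|x| <= 1]].

Definition unitary_operator (K : hilbertType R) (U : {linear K -> K}) :=
  bounded_operator U /\
  exists V : {linear K -> K},
    [/\ bounded_operator V,
        forall x y, inner (U x) y = inner x (V y),
        cancel U V & cancel V U].

(* The inclusion of H in a larger Hilbert space K is represented by an
   isometric linear map [J : H -> K], whose range is automatically closed. *)
Definition isometric_embedding (H K : hilbertType R) (J : {linear H -> K}) :=
  forall x y, inner (J x) (J y) = inner x y.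

(* [P k], seen in K through [J], is the point of the range of [J] such that
   [k - J (P k)] is orthogonal to that range. *)
Definition orthogonal_projection (H K : hilbertType R) (J : {linear H -> K})
    (P : {linear K -> H}) :=
  forall k h, inner (k - J (P k)) (J h) = 0.

Definition class_C (rho : R) (H : hilbertType R) (T : {linear H -> H}) :=
  bounded_operator T /\
  exists (K : hilbertType R) (J : {linear H -> K}) (P : {linear K -> H})
         (U : {linear K -> K}),
    [/\ isometric_embedding J, orthogonal_projection J P, unitary_operator U &
        forall n, (0 < n)%N ->
          forall x, iter n T x = rho%:C *: P (iter n U (J x))].

Definition rho_radius (rho : R) (H : hilbertType R) (A : {linear H -> H}) :
    \bar R :=
  ereal_inf [set l%:E | l in
    [set l : R | 0 < l /\ class_C rho ((l^-1)%:C \*: A)]].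

Definition psi (rho r : R) : \bar R :=
  ereal_sup [set e | exists (H : hilbertType R) (A B : {linear H -> H}),
    [/\ bounded_operator A, bounded_operator B, cancel A B /\ cancel B A,
        (rho_radius rho A <= r%:E)%E /\ (rho_radius rho B <= r%:E)%E &
        e = opnorm A]].

End Operators.

(* Main.v *)
(* A dilation [T^n = rho P U^n J] gives, by summing a geometric series,
     2 (rho - 1) Re <zeta T x, x> + (2 - rho) |T x|^2 <= rho |x|^2
   for all unimodular [zeta].  As [rho <= 2], this inequality is convex in [T],
   and it passes to adjoints; so (after scaling by [m > 1 + eps]) it holds for
   [M = (A + B') / 2], where [B'] is the adjoint of [B = A^-1].  Moreover [M]
   and its adjoint are expanding, and
     4 |M x|^2 = |A x|^2 + |B' x|^2 + 2 |x|^2.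
   Averaging over roots of unity compares [M] with a bilateral weighted shift
   with weights at least 1, the central one being [|M x|] for a unit vector [x].
   Testing with the sequence [.., t^2, t, 1, 1, t, t^2, ..] gives
   [|M x| <= 1 + (rho - 1) m (1/t - 1)] as soon as
   [(t + 1/t) / 2 >= (rho m^2 - 2 + rho) / (2 (rho - 1) m)].  For [m = 1 + s^4]
   one may take [1 - t = s^2 sqrt (2 / (rho - 1))], and then
   [|A x| + 1 / |A x| <= 2 |M x|] yields the expansion in [s = eps^(1/4)]. *)
Require Import Defs.
From HB Require Import structures.
From mathcomp Require Import all_boot all_order all_algebra.
From mathcomp Require Import cyclic separable cyclotomic.
From mathcomp Require Import complex.
From mathcomp Require Import all_classical all_reals all_analysis.
From mathcomp Require Import ring lra.

Set Implicit Arguments.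
Unset Strict Implicit.
Unset Printing Implicit Defensive.

Import Order.TTheory GRing.Theory Num.Theory.
Import numFieldNormedType.Exports.

Local Open Scope ring_scope.

(** * Real-valued norm and real part of the inner product *)

Section RealInner.
Context {R : realType} {H : hilbertType R}.
Implicit Types (x y : H) (z : R[i]).

Definition rnorm x : R := complex.Re `|x|.
Definition rinner x y : R := complex.Re (inner x y).

Lemma rnormE x : `|x| = (rnorm x)%:C%C.
Proof. by rewrite /rnorm RRe_real ?normr_real. Qed.

Lemma rnorm_ge0 x : 0 <= rnorm x.
Proof. by rewrite -ler0c -rnormE normr_ge0. Qed.

Lemma rnormD x y : rnorm (x + y) <= rnorm x + rnorm y.
Proof. by rewrite -lecR rmorphD /= -!rnormE ler_normD. Qed.

Lemma rnormZ z (c : R) x : `|z| = c%:C%C -> rnorm (z *: x) = c * rnorm x.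
Proof. by move=> zc; apply: complexI; rewrite -rnormE normrZ zc rmorphM /= -rnormE. Qed.

Lemma rnorm_eq0 x : (rnorm x == 0) = (x == 0).
Proof. by rewrite -[RHS]normr_eq0 rnormE (inj_eq (@complexI R)). Qed.

Lemma rnorm0 : rnorm 0 = 0.
Proof. by apply/eqP; rewrite rnorm_eq0. Qed.

Lemma innerC x y : inner x y = (inner y x)^*%C.
Proof. by rewrite hermC expr0 mul1r. Qed.

Lemma innerDl x1 x2 y : inner (x1 + x2) y = inner x1 y + inner x2 y.
Proof. by rewrite linearDl. Qed.
Lemma innerDr x y1 y2 : inner x (y1 + y2) = inner x y1 + inner x y2.
Proof. by rewrite linearDr. Qed.
Lemma innerZl z x y : inner (z *: x) y = z * inner x y.
Proof. by rewrite linearZl_LR. Qed.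
Lemma innerZr z x y : inner x (z *: y) = z^*%C * inner x y.
Proof. by rewrite linearZr_LR. Qed.
Lemma innerNl x y : inner (- x) y = - inner x y.
Proof. by rewrite linearNl. Qed.
Lemma innerNr x y : inner x (- y) = - inner x y.
Proof. by rewrite linearNr. Qed.

Lemma inner_suml I (r : seq I) (F : I -> H) y :
  inner (\sum_(i <- r) F i) y = \sum_(i <- r) inner (F i) y.
Proof. exact: linear_sumlz. Qed.
Lemma inner_sumr I (r : seq I) (F : I -> H) x :
  inner x (\sum_(i <- r) F i) = \sum_(i <- r) inner x (F i).
Proof. exact: linear_sumr. Qed.

Lemma inner_rnorm x : inner x x = (rnorm x ^+ 2)%:C%C.
Proof. by rewrite -normr_inner rnormE rmorphXn. Qed.

Lemma rnorm2 x : rnorm x ^+ 2 = rinner x x.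
Proof. by rewrite /rinner inner_rnorm. Qed.

Lemma inner_inj x y : (forall u, inner u x = inner u y) -> x = y.
Proof.
move=> E; apply/eqP; rewrite -subr_eq0 -rnorm_eq0 -sqrf_eq0 rnorm2 /rinner.
by rewrite innerDr innerNr E subrr.
Qed.

Lemma rinnerC x y : rinner x y = rinner y x.
Proof. by rewrite /rinner innerC; case: (inner y x). Qed.
Lemma rinnerDl x1 x2 y : rinner (x1 + x2) y = rinner x1 y + rinner x2 y.
Proof. by rewrite /rinner innerDl; case: (inner x1 y); case: (inner x2 y). Qed.
Lemma rinnerDr x y1 y2 : rinner x (y1 + y2) = rinner x y1 + rinner x y2.
Proof. by rewrite !(rinnerC x) rinnerDl. Qed.
Lemma rinnerNl x y : rinner (- x) y = - rinner x y.
Proof. by rewrite /rinner innerNl; case: (inner x y). Qed.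
Lemma rinnerNr x y : rinner x (- y) = - rinner x y.
Proof. by rewrite !(rinnerC x) rinnerNl. Qed.
Lemma rinner0l y : rinner 0 y = 0.
Proof. by rewrite -[0 in LHS](subrr y) rinnerDl rinnerNl subrr. Qed.
Lemma rinner0r x : rinner x 0 = 0.
Proof. by rewrite rinnerC rinner0l. Qed.
Lemma rinnerZl (c : R) x y : rinner (c%:C%C *: x) y = c * rinner x y.
Proof. by rewrite /rinner innerZl; case: (inner x y) => a b /=; rewrite mul0r subr0. Qed.
Lemma rinnerZr (c : R) x y : rinner x (c%:C%C *: y) = c * rinner x y.
Proof. by rewrite !(rinnerC x) rinnerZl. Qed.

Lemma rinner_le x y : rinner x y <= rnorm x * rnorm y.
Proof.
have := rnormD x y; have := rnorm_ge0 x; have := rnorm_ge0 y.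
move=> y0 x0 /(lerXn2r 2 (rnorm_ge0 _)).
rewrite nnegrE addr_ge0// => /(_ isT); rewrite rnorm2 !(rinnerDl, rinnerDr).
by rewrite (rinnerC y x) sqrrD -!rnorm2 mulr2n; lra.
Qed.

Lemma rinner_ge x y : - (rnorm x * rnorm y) <= rinner x y.
Proof.
have := rinner_le (- x) y; rewrite rinnerNl.
by rewrite /rnorm normrN; lra.
Qed.

End RealInner.

(** Passage to the limit in finite truncations; it serves both the Neumann series of the dilation
    and the truncated test sequence. *)
Lemma ge0_of_geometric (R : realType) (q C X : R) :
  0 <= q < 1 -> (forall n, - (C * q ^+ n) <= X) -> 0 <= X.
Proof.
move=> /andP[q0 q1] CX; rewrite leNgt; apply/negP => X0.
have C0 : 0 < C by have := CX 0%N; rewrite expr0; lra.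
have /cvgrPdist_lt/(_ (- X / C)) : (q ^+ n @[n --> \oo] --> (0 : R))%classic.
  by apply: cvg_expr; rewrite ger0_norm.
case; first by rewrite divr_gt0// oppr_gt0.
move=> n _ /(_ n (leqnn n)) /=; rewrite sub0r normrN ger0_norm ?exprn_ge0//.
by rewrite ltr_pdivlMr// => h; have := CX n; lra.
Qed.

Lemma rnorm_addsub (R : realType) (H : hilbertType R) (u v w : H) :
  rnorm (u + v - w) ^+ 2 = rnorm u ^+ 2 + rnorm v ^+ 2 + rnorm w ^+ 2
    + 2 * rinner u v - 2 * rinner u w - 2 * rinner v w.
Proof.
rewrite !rnorm2 !(rinnerDl, rinnerDr, rinnerNl, rinnerNr).
by rewrite (rinnerC w u) (rinnerC w v) (rinnerC v u); ring.
Qed.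

(** * From a unitary dilation to a quadratic inequality *)

Section Dilation.
Context {R : realType} {H K : hilbertType R}.
Variables (rho : R) (T : {linear H -> H}).
Variables (J : {linear H -> K}) (P : {linear K -> H}) (U V : {linear K -> K}).
Hypotheses (rho0 : 0 < rho)
  (Jisom : isometric_embedding J) (JP : orthogonal_projection J P)
  (UV : forall x y, inner (U x) y = inner x (V y)) (VU : cancel U V)
  (dil : forall n, (0 < n)%N ->
     forall x, iter n T x = rho%:C%C *: P (iter n U (J x))).

Lemma projK : cancel J P.
Proof.
move=> y; apply/esym/inner_inj => u; apply/eqP; rewrite -subr_eq0 -innerNr -innerDr.
by rewrite innerC -Jisom linearB JP conjc0.
Qed.

Lemma inner_proj k y : inner (P k) y = inner k (J y).
Proof.
apply/eqP; rewrite eq_sym -subr_eq0 -Jisom -innerNl -innerDl; apply/eqP; exact: JP.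
Qed.

Lemma rinner_proj k y : rinner (P k) y = rinner k (J y).
Proof. by rewrite /rinner inner_proj. Qed.

Lemma rnorm_isom y : rnorm (J y) = rnorm y.
Proof.
by apply/eqP; rewrite -(eqrXn2 (n:=2)) ?rnorm_ge0// !rnorm2 /rinner Jisom.
Qed.

Lemma rnorm_unitary k : rnorm (U k) = rnorm k.
Proof. by apply/eqP; rewrite -(eqrXn2 (n:=2)) ?rnorm_ge0// !rnorm2 /rinner UV VU. Qed.

Lemma rnorm_iter_unitary n k : rnorm (iter n U k) = rnorm k.
Proof. by elim: n => //= n IH; rewrite rnorm_unitary. Qed.

Section Resolvent.
Variables (q : R) (z : R[i]) (x : H).
Hypotheses (q01 : 0 <= q < 1) (zq : `|z| = q%:C%C).

Let y := x - z *: T x.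

(** Partial sums of [(1 - z U)^-1 (J y)], in Horner form so that each one is [J y] plus [z U] of the
    preceding one. *)
Fixpoint neumann n := if n is m.+1 then J y + z *: U (neumann m) else 0.

Let geo n := z ^+ n *: iter n U (J y).

Lemma geo_unitaryS n : geo n.+1 = z *: U (geo n).
Proof. by rewrite /geo linearZ /= scalerA exprS. Qed.

Lemma normzX n : `|z ^+ n| = (q ^+ n)%:C%C.
Proof. by rewrite normrX zq rmorphXn. Qed.

Lemma neumannS n : neumann n.+1 = neumann n + geo n.
Proof.
elim: n => [|n IH]; first by rewrite /= linear0 scaler0 addr0 add0r /geo scale1r.
have -> : neumann n.+2 = J y + z *: U (neumann n.+1) by [].
by rewrite IH linearD scalerDr -geo_unitaryS addrA -IH.
Qed.

Lemma rnorm_neumann n : rnorm (neumann n) <= (1 - q)^-1 * rnorm y.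
Proof.
have [q0 q1] := andP q01; have q1' : 0 < 1 - q by lra.
elim: n => [|n IH] /=.
  by rewrite rnorm0 mulr_ge0// ?rnorm_ge0// invr_ge0 ltW.
apply: (le_trans (rnormD _ _)); rewrite (rnormZ _ zq) rnorm_unitary rnorm_isom.
apply: (@le_trans _ _ (rnorm y + q * ((1 - q)^-1 * rnorm y))).
  by rewrite lerD2l ler_wpM2l.
by rewrite le_eqVlt; apply/orP; left; apply/eqP; field; lra.
Qed.

Lemma rhoC0 : rho%:C%C != 0 :> R[i].
Proof. by rewrite (inj_eq (@complexI R)) gt_eqF. Qed.

Lemma proj_iter n w : (0 < n)%N -> P (iter n U (J w)) = (rho^-1)%:C%C *: iter n T w.
Proof. by move=> n0; rewrite dil// scalerA fmorphV mulVf ?rhoC0 ?scale1r. Qed.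

(** The dilation turns [P (1 - z U)^-1 J] into [1 + rho^-1 z T (1 - z T)^-1]. On [y = x - z T x] the
    resolvent of [T] cancels, so the partial sums telescope. *)
Lemma proj_neumann n : P (neumann n.+1) =
  y + (rho^-1)%:C%C *: (z *: T x - z ^+ n.+1 *: iter n.+1 T x).
Proof.
elim: n => [|n IH].
  by rewrite /= linear0 scaler0 addr0 projK expr1 subrr scaler0 addr0.
rewrite neumannS linearD IH -addrA; congr (_ + _).
rewrite /geo [P (_ *: _)]linearZ_LR proj_iter// /y.
rewrite scalerA mulrC -scalerA -scalerDr; congr (_ *: _).
have -> : iter n.+1 T (x - z *: T x) = iter n.+1 T x - z *: iter n.+2 T x.
  rewrite [iter n.+2 _ _]iterSr; elim: n.+1 => //= m ->.
  by rewrite linearB linearZ.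
by rewrite scalerBr scalerA -exprSr addrA subrK.
Qed.

(** For [|z| < 1] the real part of [(1 - z U)^-1] is at least 1/2: with [k] a partial sum and [g]
    the next term, [k + g - J y = z U k] is no longer than [k], and expanding the square gives
    [2 Re <k, J y> >= |J y|^2] up to terms of order [q ^+ n]. *)
Lemma resolvent_ge0 : 0 <= rnorm y ^+ 2 + 2 * rho^-1 * rinner (z *: T x) y.
Proof.
(* [C] collects the remainders [<g, J y>], [<k, g>] and the tail in [kJ], with spare room in its
   first term. *)
pose C := 4 * rnorm y * rnorm y + 2 * ((1 - q)^-1 * rnorm y) * rnorm y
   + 2 * rnorm x * rnorm y.
apply: (@ge0_of_geometric _ q C) => // n.
have [q0 q1] := andP q01.
apply: (@le_trans _ _ (- (C * q ^+ n.+1))).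
  rewrite lerN2 exprS mulrCA ler_piMl ?(ltW q1)// mulr_ge0 ?exprn_ge0//.
  by rewrite /C !addr_ge0 ?mulr_ge0 ?rnorm_ge0// invr_ge0; lra.
set k := neumann n.+1; set g := geo n.+1.
have gE : rnorm g = q ^+ n.+1 * rnorm y.
  by rewrite /g (rnormZ _ (normzX _)) rnorm_iter_unitary rnorm_isom.
have kE : rnorm (k + g - J y) ^+ 2 <= rnorm k ^+ 2.
  rewrite /k /g -neumannS /= addrAC subrr add0r (rnormZ _ zq) rnorm_unitary.
  have := rnorm_ge0 k; rewrite -/k => k0; rewrite exprMn ler_piMl ?exprn_ge0//.
  by rewrite exprn_ile1// ltW.
have kJ : rinner k (J y) = rnorm y ^+ 2 + rho^-1 * rinner (z *: T x) y
    - rinner (z ^+ n.+1 *: iter n.+1 U (J x)) (J y).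
  rewrite -rinner_proj proj_neumann rinnerDl rinnerZl.
  rewrite (rinnerDl (z *: T x)) rinnerNl rnorm2 mulrDr mulrN -addrA; congr (_ + (_ - _)).
  rewrite -rinner_proj linearZ_LR proj_iter//.
  by rewrite scalerA [z ^+ _ * _]mulrC -scalerA rinnerZl.
have kg := rinner_ge k g; have gJ := rinner_le g (J y).
have wJ := rinner_ge (z ^+ n.+1 *: iter n.+1 U (J x)) (J y).
rewrite (rnormZ _ (normzX _)) rnorm_iter_unitary !rnorm_isom gE in wJ gJ kg.
move: kE; rewrite rnorm_addsub kJ rnorm_isom.
have kn := rnorm_neumann n.+1; rewrite -/k in kn.
have g2 : 0 <= rnorm g ^+ 2 by rewrite sqr_ge0.
move: kg => /(le_trans _) kg.
have {kg}/kg : - (q ^+ n.+1 * (((1 - q)^-1 * rnorm y) * rnorm y)) <=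
   - (rnorm k * (q ^+ n.+1 * rnorm y)).
  rewrite lerN2 mulrCA ler_wpM2l ?exprn_ge0// ler_wpM2r ?rnorm_ge0//.
move: (rinner _ _) (rinner _ _) (rinner _ _) (rinner _ _) gJ wJ => a b c d.
have : 0 <= q ^+ n.+1 * (rnorm y * rnorm y) by rewrite !mulr_ge0 ?exprn_ge0 ?rnorm_ge0.
rewrite /C; lra.
Qed.

Lemma dilation_ineq : 2 * (rho - 1) * rinner (z *: T x) x
   + (2 - rho) * q ^+ 2 * rnorm (T x) ^+ 2 <= rho * rnorm x ^+ 2.
Proof.
have -> : (2 - rho) * q ^+ 2 * rnorm (T x) ^+ 2 = (2 - rho) * rnorm (z *: T x) ^+ 2.
  by rewrite (rnormZ _ zq); ring.
have := resolvent_ge0; rewrite rnorm2 /y !(rinnerDl, rinnerDr, rinnerNl, rinnerNr).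
rewrite (rinnerC x) -!rnorm2; move: (rinner _ _) (_ ^+ 2) (_ ^+ 2) => a b c.
rewrite -(pmulr_rge0 _ rho0) => h.
have -> : rho * c = 2 * (rho - 1) * a + (2 - rho) * b
    + rho * (c - a + (- a - - b) + 2 / rho * (a - b)) by field; rewrite gt_eqF.
by rewrite lerDl.
Qed.

End Resolvent.
End Dilation.

(** * Adjoints, and the quadratic inequality for operators of bounded rho-radius *)

Section Radius.
Context {R : realType} {H : hilbertType R}.
Implicit Types (T A : {linear H -> H}) (rho m : R).

Definition adjoint_to (K : hilbertType R) (T T' : K -> K) :=
  forall x y, inner (T x) y = inner x (T' y).

Lemma adjoint_sym (K : hilbertType R) (T T' : K -> K) :
  adjoint_to T T' -> adjoint_to T' T.
Proof. by move=> TT' x y; rewrite innerC -TT' -innerC. Qed.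

Lemma adjoint_iter (K : hilbertType R) (T T' : K -> K) n :
  adjoint_to T T' -> adjoint_to (iter n T) (iter n T').
Proof. by move=> TT'; elim: n => // n IH x y; rewrite iterS TT' IH -iterSr. Qed.

(** Naming the adjoint [V] of [U] makes the data symmetric: a dilation of the adjoint of [T] arises
    by swapping [U] and [V]. *)
Definition has_dilation rho T :=
  exists (K : hilbertType R) (J : {linear H -> K}) (P : {linear K -> H})
         (U V : {linear K -> K}),
    [/\ isometric_embedding J /\ orthogonal_projection J P, adjoint_to U V,
        cancel U V, cancel V U &
        forall n, (0 < n)%N ->
          forall x, iter n T x = rho%:C%C *: P (iter n U (J x))].

Lemma class_C_dilation rho T : class_C rho T -> has_dilation rho T.
Proof.
move=> [_ [K [J [P [U [Ji JP [_ [V [_ UV UVK VUK]]] d]]]]]].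
by exists K, J, P, U, V.
Qed.

(* The adjoint is read off the dilation as [rho P U^* J], so that no
   representation theorem is needed. *)
Lemma has_dilation_adjoint rho T : has_dilation rho T ->
  exists2 T' : {linear H -> H}, adjoint_to T T' & has_dilation rho T'.
Proof.
move=> [K [J [P [U [V [[Ji JP] UV UVK VUK d]]]]]].
have PJ k y := inner_proj Ji JP k y.
have rhoJ : (rho%:C%C)^*%C = rho%:C%C :> R[i] by rewrite conjc_real.
have dV n x y : (0 < n)%N ->
    inner (iter n T x) y = inner x (rho%:C%C *: P (iter n V (J y))).
  move=> n0; rewrite d// innerZl PJ (adjoint_iter _ UV) innerZr rhoJ.
  by rewrite [in RHS]innerC PJ -innerC.
pose T' : {linear H -> H} := rho%:C%C \*: (P \o (V \o J)).
have TT' : adjoint_to T T' by move=> x y; exact: (dV 1%N).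
exists T' => //; exists K, J, P, V, U; split => //; first exact: adjoint_sym.
by move=> n n0 x; apply: inner_inj => u; rewrite -(adjoint_iter _ TT') dV.
Qed.

(** The dilation inequality for [m^-1 T] on the unit circle, multiplied by [m ^+ 2]. *)
Definition form_bound rho m T := forall (zeta : R[i]) x, `|zeta| = 1 ->
  2 * (rho - 1) * m * rinner (zeta *: T x) x + (2 - rho) * rnorm (T x) ^+ 2
    <= rho * m ^+ 2 * rnorm x ^+ 2.

Lemma has_dilation_form_bound rho l m A : 0 < rho -> 0 < l < m ->
  has_dilation rho ((l^-1)%:C%C \*: A) -> form_bound rho m A.
Proof.
move=> rho0 /andP[l0 lm] [K [J [P [U [V [[Ji JP] UV UVK VUK d]]]]]] zeta x z1.
have m0 : 0 < m by lra.
(* The room [l < m] is spent here: the modulus [q = l / m] lies below 1, and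
   [z (l^-1 A) = zeta (m^-1 A)] for [z = q zeta]. *)
have q01 : 0 <= l / m < 1 by rewrite divr_ge0 ?(ltW l0) ?(ltW m0)//= ltr_pdivrMr// mul1r.
have zq : `|(l / m)%:C%C * zeta| = (l / m)%:C%C.
  by rewrite normrM z1 mulr1 ger0_norm// ler0c; case/andP: q01.
have := dilation_ineq rho0 Ji JP UV UVK d x q01 zq => /=.
have -> : ((l / m)%:C%C * zeta) *: ((l^-1)%:C%C *: A x) =
   (m^-1)%:C%C *: (zeta *: A x).
  rewrite !scalerA mulrAC -rmorphM; congr ((_%:C%C * _) *: _).
  by field; rewrite !gt_eqF.
rewrite rinnerZl (rnormZ (c := l^-1)); last by rewrite ger0_norm// ler0c invr_ge0 ltW.
move=> /(ler_wpM2l (exprn_ge0 2 (ltW m0))).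
set a := rinner _ _; set b := rnorm (A x); set c := rnorm x.
have -> : m ^+ 2 * (2 * (rho - 1) * (m^-1 * a)
      + (2 - rho) * (l / m) ^+ 2 * (l^-1 * b) ^+ 2) =
    2 * (rho - 1) * m * a + (2 - rho) * b ^+ 2.
  by field; rewrite !gt_eqF.
by have -> : m ^+ 2 * (rho * c ^+ 2) = rho * m ^+ 2 * c ^+ 2 by ring.
Qed.

(** The infimum need not be attained, but [r < m] leaves some [l < m] with [l^-1 A] in the class;
    the adjoint of [A] is [l] times that of [l^-1 A]. *)
Lemma rho_radius_form_bound rho r m A : 0 < rho -> r < m ->
  (rho_radius rho A <= r%:E)%E ->
  exists A' : {linear H -> H},
    [/\ adjoint_to A A', form_bound rho m A & form_bound rho m A'].
Proof.
move=> rho0 rm wr.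
have : (rho_radius rho A < m%:E)%E by apply: (le_lt_trans wr); rewrite lte_fin.
move=> /ereal_inf_lt[_ [l [l0 cl] <-]]; rewrite lte_fin => lm.
have dl := class_C_dilation cl.
have [T' TT' dT'] := has_dilation_adjoint dl.
pose A' : {linear H -> H} := l%:C%C \*: T'.
have lC : l%:C%C != 0 :> R[i] by rewrite (inj_eq (@complexI R)) gt_eqF.
have lm0 : 0 < l < m by rewrite l0.
exists A'; split; last 2 first.
- exact: has_dilation_form_bound dl.
- apply: (has_dilation_form_bound rho0 lm0).
  case: dT' => [K [J [P [U [V [? ? ? ? d]]]]]]; exists K, J, P, U, V; split => //.
  move=> n n0 x; rewrite -d//; elim: n {n0} => // k IH.
  by rewrite !iterS IH /= scalerA fmorphV mulVf ?scale1r.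
move=> x y; rewrite /A' /= innerZr conjc_real -TT' /= innerZl mulrA fmorphV.
by rewrite mulfV ?mul1r.
Qed.

End Radius.

(** * Averaging over roots of unity *)

Lemma closed_prim_root_exists (F : numClosedFieldType) n : (0 < n)%N ->
  exists z : F, n.-primitive_root z.
Proof.
pose p : {poly F} := 'X^n - 1; have [r Dp] := closed_field_poly_normal p.
move=> n_gt0; rewrite (monicP _) ?monicXnsubC // scale1r in Dp.
have rn1 : all n.-unity_root r by apply/allP=> z; rewrite -root_prod_XsubC -Dp.
have sz_r : (n < (size r).+1)%N.
  by rewrite -(size_prod_XsubC r id) -Dp size_XnsubC.
have [|z] := hasP (has_prim_root n_gt0 rn1 _ sz_r); last by exists z.
by rewrite -separable_prod_XsubC -Dp separable_Xn_sub_1 // pnatr_eq0 -lt0n.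
Qed.

Section RootsOfUnity.
Context {R : realType} {H : hilbertType R}.
Variables (L : nat) (w : R[i]).
Hypothesis w_prim : L.-primitive_root w.

Let L_gt0 : (0 < L)%N := prim_order_gt0 w_prim.

Lemma norm_prim_root : `|w| = 1.
Proof.
apply/eqP; rewrite -(pexpr_eq1 L_gt0 (normr_ge0 _)) -normrX.
by rewrite (prim_expr_order w_prim) normr1.
Qed.

Lemma sum_prim_root (n p : 'I_L) :
  \sum_(j < L) w ^+ (j * n) * (w ^+ (j * p))^*%C = (n == p)%:R * L%:R.
Proof.
have wX0 k : w ^+ k != 0 by rewrite expf_neq0// -normr_gt0 norm_prim_root.
have conjw k : (w ^+ k)^*%C = (w ^+ k)^-1.
  by rewrite invc_norm normrX norm_prim_root !expr1n invr1 mul1r.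
pose x := w ^+ n / w ^+ p.
under eq_bigr => j _.
  rewrite conjw mulnC exprM (mulnC j) exprM -exprVn -exprMn -/x; over.
have xL : x ^+ L = 1.
  rewrite /x exprMn exprVn -!exprM !(mulnC _ L) !exprM (prim_expr_order w_prim).
  by rewrite !expr1n invr1 mulr1.
case: eqVneq => [np|np].
  rewrite mul1r /x np mulfV// -[in RHS](card_ord L) -sumr_const.
  by apply: eq_bigr => j _; rewrite expr1n.
rewrite mul0r; apply/eqP.
have x1 : x - 1 != 0.
  rewrite subr_eq0 /x -(inj_eq (mulIf (wX0 p))) divfK// mul1r.
  by rewrite (eq_prim_root_expr w_prim) !modn_small.
by rewrite -(inj_eq (mulfI x1)) mulr0 -subrX1 xL subrr.
Qed.

Definition dft (v : nat -> H) (j : nat) := \sum_(n < L) w ^+ (j * n) *: v n.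

Lemma parseval (a b : nat -> H) :
  \sum_(j < L) inner (dft a j) (dft b j) = L%:R * \sum_(n < L) inner (a n) (b n).
Proof.
have E j : inner (dft a j) (dft b j) = \sum_(n < L) \sum_(p < L)
    w ^+ (j * n) * (w ^+ (j * p))^*%C * inner (a n) (b p).
  rewrite /dft inner_suml; apply: eq_bigr => n _.
  rewrite inner_sumr; apply: eq_bigr => p _.
  by rewrite innerZl innerZr mulrA.
under eq_bigr => j _ do rewrite E.
rewrite exchange_big mulr_sumr; apply: eq_bigr => n _ /=.
rewrite exchange_big (bigD1 n)//= [X in _ + X]big1 => [|p pn].
  by rewrite -mulr_suml sum_prim_root eqxx mul1r addr0.
by rewrite -mulr_suml sum_prim_root eq_sym (negbTE pn) !mul0r.
Qed.

Lemma parsevalR (a b : nat -> H) :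
  \sum_(j < L) rinner (dft a j) (dft b j) = L%:R * \sum_(n < L) rinner (a n) (b n).
Proof.
have ReD I (r : seq I) (P : pred I) (F : I -> R[i]) :
    complex.Re (\sum_(i <- r | P i) F i) = \sum_(i <- r | P i) complex.Re (F i).
  by apply: (big_morph (@complex.Re R)) => // [[? ?] [? ?]].
rewrite /rinner -!ReD parseval -(rmorph_nat (real_complex R)).
by case: (\sum_(n < L) _) => c d /=; rewrite mul0r subr0.
Qed.

(** A twist by [w ^+ j] is a cyclic shift by one place; the two zero boundary values make it an
    honest shift. *)
Lemma dft_shift (a : nat -> H) j : a L = 0 -> a 0 = 0 ->
  w ^+ j *: dft (fun n => a n.+1) j = dft a j.
Proof.
move=> aL a0; rewrite /dft scaler_sumr.
transitivity (\sum_(n < L.+1) w ^+ (j * n) *: a n).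
  rewrite big_ord_recl /= a0 scaler0 add0r; apply: eq_bigr => n _.
  by rewrite scalerA -exprD /bump /= mulnS.
by rewrite big_ord_recr /= aL scaler0 addr0.
Qed.

Lemma dft_linear (M : {linear H -> H}) (v : nat -> H) j :
  M (dft v j) = dft (M \o v) j.
Proof.
by rewrite /dft raddf_sum; apply: eq_bigr => n _; rewrite /= linearZ.
Qed.

End RootsOfUnity.

(* Averaging the quadratic inequality over the rotations [sum_n w^(jn) v_n]
   kills all cross terms but those between neighbours. *)
Lemma form_bound_path (R : realType) (H : hilbertType R) (rho m : R)
    (M : {linear H -> H}) (v : nat -> H) k : form_bound rho m M ->
  2 * (rho - 1) * m * \sum_(n < k) rinner (M (v n)) (v n.+1)
    + (2 - rho) * \sum_(n < k.+1) rnorm (M (v n)) ^+ 2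
  <= rho * m ^+ 2 * \sum_(n < k.+1) rnorm (v n) ^+ 2.
Proof.
(* The order is [k.+2] for [k.+1] vectors: the zero entry of [u] at [k.+1] prevents the two ends
   from becoming neighbours. *)
move=> bM; have [w w_prim] := closed_prim_root_exists R[i] (ltn0Sn k.+1).
pose u n := if (n <= k)%N then v n else 0.
pose a n := if n is p.+1 then M (u p) else 0.
have uE n : (n <= k)%N -> u n = v n by rewrite /u => ->.
(* The form bound is applied to [dft u] with [zeta = w ^+ j]; the twisted image is the transform of
   [a], the sequence [M u] shifted right. *)
have : \sum_(j < k.+2) (2 * (rho - 1) * m * rinner (dft k.+2 w a j) (dft k.+2 w u j)
     + (2 - rho) * rinner (dft k.+2 w (M \o u) j) (dft k.+2 w (M \o u) j))
   <= \sum_(j < k.+2) rho * m ^+ 2 * rinner (dft k.+2 w u j) (dft k.+2 w u j).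
  apply: ler_sum => j _; rewrite -dft_linear -dft_shift /a//; last first.
    by rewrite /u ltnn linear0.
  rewrite -/(M \o u) -(dft_linear _ _ M) -!rnorm2; apply: bM.
  by rewrite normrX (norm_prim_root w_prim) expr1n.
rewrite big_split /= -!mulr_sumr !(parsevalR w_prim).
rewrite !mulrA !(mulrC _ k.+2%:R) -!mulrA -mulrDr ler_pM2l ?ltr0n//.
have uk : u k.+1 = 0 by rewrite /u ltnn.
rewrite big_ord_recl [in X in _ + X]big_ord_recr [in X in _ <= X]big_ord_recr /=.
rewrite uk linear0 -!rnorm2 rnorm0 expr0n addr0 big_ord_recr /=.
rewrite rinner0l add0r [bump 0 k]add1n uk rinner0r !addr0.
under eq_bigr => n _ do rewrite add0n [bump 0 n]add1n !uE ?(ltnW (ltn_ord n))//.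
under [X in _ + _ * X]eq_bigr => n _ do rewrite -rnorm2 uE -1?ltnS//.
under [X in _ <= _ * (_ * (_ * X))]eq_bigr => n _ do rewrite -rnorm2 uE -1?ltnS//.
by rewrite !mulrA.
Qed.

(** * The test sequence for the bilateral shift *)

Section Chain.
Context {R : realType} {H : hilbertType R}.
Variables (rho m t mu : R) (M : {linear H -> H}) (g h : nat -> H).
Hypotheses (rho12 : 1 <= rho <= 2) (m0 : 0 < m) (t01 : 0 < t < 1)
  (bM : form_bound rho m M)
  (tE : rho * m ^+ 2 - (2 - rho) <= (rho - 1) * m * (t + t^-1))
  (gh0 : g 0%N = h 0%N) (g1 : forall i, rnorm (g i) = 1)
  (h1 : forall i, rnorm (h i) = 1)
  (Mg : forall i, 1 <= rnorm (M (g i))) (Mh : forall i, 1 <= rnorm (M (h i)))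
  (gS : forall i, 1 <= rinner (M (g i.+1)) (g i))
  (hS : forall i, 1 <= rinner (M (h i)) (h i.+1))
  (mu1 : rinner (M (h 0%N)) (h 1%N) = mu) (mu2 : rnorm (M (h 0%N)) = mu).

Let t_gt0 : 0 < t. Proof. by case/andP: t01. Qed.
Let t_lt1 : t < 1. Proof. by case/andP: t01. Qed.
Let rho_ge1 : 1 <= rho. Proof. by case/andP: rho12. Qed.
Let rho_le2 : rho <= 2. Proof. by case/andP: rho12. Qed.

(** Positions [N] and [N.+1] carry [h 0] and [h 1], both with coefficient 1, so that the central
    edge enters with its full weight [mu]; coefficients decay by [t] on either side. *)
Let chain N n := if (n <= N)%N then (t ^+ (N - n))%:C%C *: g (N - n)
  else (t ^+ (n - N.+1))%:C%C *: h (n - N).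

Lemma chain_left N i : (i <= N)%N -> chain N (N - i) = (t ^+ i)%:C%C *: g i.
Proof. by move=> iN; rewrite /chain leq_subr subKn. Qed.

Lemma chain_mid N : chain N N = h 0%N.
Proof. by have := chain_left (leq0n N); rewrite subn0 scale1r gh0. Qed.

Lemma chain_right N i : chain N (N.+1 + i) = (t ^+ i)%:C%C *: h i.+1.
Proof.
by rewrite /chain leqNgt addSn ltnS leq_addr /= subSS addKn -addnS addKn.
Qed.

Lemma rnorm_chain (u : H) i : rnorm ((t ^+ i)%:C%C *: u) ^+ 2
   = (t ^+ 2) ^+ i * rnorm u ^+ 2.
Proof.
have t0 : 0 <= t ^+ i by rewrite exprn_ge0// ltW.
by rewrite (rnormZ (c := t ^+ i)) ?ger0_norm ?ler0c// exprMn -!exprM mulnC.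
Qed.

Lemma rinner_chain (u u' : H) i j : rinner (M ((t ^+ i)%:C%C *: u))
   ((t ^+ j)%:C%C *: u') = t ^+ (i + j) * rinner (M u) u'.
Proof. by rewrite linearZ rinnerZl rinnerZr mulrA -exprD. Qed.

Lemma sum_rev_split (F : nat -> R) N p : \sum_(n < N.+1 + p) F n =
  \sum_(i < N.+1) F (N - i)%N + \sum_(i < p) F (N.+1 + i)%N.
Proof.
rewrite big_split_ord /= (reindex_inj rev_ord_inj) /=.
by congr (_ + _); apply: eq_bigr => i _; rewrite subSS.
Qed.

Let S N : R := \sum_(i < N.+1) (t ^+ 2) ^+ i.

Lemma chain_norm2 N : \sum_(n < N.+1 + N.+1) rnorm (chain N n) ^+ 2 = 2 * S N.
Proof.
rewrite (sum_rev_split (fun n => rnorm (chain N n) ^+ 2)) mulr_natl mulr2n.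
congr (_ + _); apply: eq_bigr => i _.
  by rewrite chain_left -1?ltnS// rnorm_chain g1 expr1n mulr1.
by rewrite chain_right rnorm_chain h1 expr1n mulr1.
Qed.

(** All images are bounded below by the vectors themselves, except at position [N], where the excess
    [mu ^+ 2 - 1] is kept. *)
Lemma chain_image_norm2 N : 2 * S N + (mu ^+ 2 - 1) <=
  \sum_(n < N.+1 + N.+1) rnorm (M (chain N n)) ^+ 2.
Proof.
have t2 i : 0 <= (t ^+ 2) ^+ i by rewrite !exprn_ge0// ltW.
have sq1 (y : R) : 1 <= y -> 1 <= y ^+ 2 by move=> y1; rewrite expr_ge1//; lra.
rewrite (sum_rev_split (fun n => rnorm (M (chain N n)) ^+ 2)) [2 * _]mulr_natl.
rewrite mulr2n addrAC; apply: lerD.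
  rewrite /S !big_ord_recl /= expr0 subn0 chain_mid mu2.
  rewrite addrC addrA subrK lerD2l; apply: ler_sum => i _.
  rewrite [bump 0 i]add1n chain_left ?ltn_ord//.
  rewrite linearZ rnorm_chain ler_peMr//; exact: sq1.
apply: ler_sum => i _; rewrite chain_right linearZ rnorm_chain ler_peMr//; exact: sq1.
Qed.

(** Besides the central edge there are [N] edges on each side, contributing at least
    [t ^+ (2 i + 1)]; hence the last term of [S N] is removed. *)
Lemma chain_edges N : 2 * (t * (S N - (t ^+ 2) ^+ N)) + mu <=
  \sum_(n < N.+1 + N) rinner (M (chain N n)) (chain N n.+1).
Proof.
have t0 i : 0 <= t ^+ i by rewrite !exprn_ge0// ltW.
have -> : t * (S N - (t ^+ 2) ^+ N) = \sum_(i < N) t ^+ (i + i.+1).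
  rewrite /S big_ord_recr addrK /= mulr_sumr; apply: eq_bigr => i _.
  by rewrite -exprM -exprS addnS addnn -mul2n.
rewrite (sum_rev_split (fun n => rinner (M (chain N n)) (chain N n.+1))).
rewrite mulr_natl mulr2n addrAC; apply: lerD.
  rewrite big_ord_recl /= subn0 chain_mid.
  rewrite -[X in chain N X]addn0 chain_right scale1r mu1 addrC lerD2l.
  apply: ler_sum => i _; rewrite [bump 0 i]add1n subnSK// !chain_left//; last exact: ltnW.
  by rewrite rinner_chain addnC ler_peMr.
apply: ler_sum => i _; rewrite -addnS !chain_right rinner_chain ler_peMr//.
Qed.

(** By [tE], the terms in [S N] leave at most [2 (rho - 1) m (t^-1 - t) S N], and the geometric sum
    makes [(t^-1 - t) S N] tend to [t^-1]. *)
Lemma chain_bound :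
  2 * (rho - 1) * m * mu + (2 - rho) * (mu ^+ 2 - 1) <= 2 * (rho - 1) * m * t^-1.
Proof.
rewrite -subr_ge0; apply: (@ge0_of_geometric _ t (2 * (rho - 1) * m)).
  by rewrite ltW.
have [t0 t1 r1 r2] := And4 t_gt0 t_lt1 rho_ge1 rho_le2.
move=> N; have := form_bound_path (chain N) (N.+1 + N) bM.
rewrite -addnS chain_norm2 => le1.
have k0 : 0 <= 2 * (rho - 1) * m by rewrite !mulr_ge0 ?subr_ge0 ?(ltW m0).
have e0 : 0 <= 2 - rho by lra.
have le2 := ler_wpM2l e0 (chain_image_norm2 N).
have le3 := ler_wpM2l k0 (chain_edges N).
have SE : (1 - t ^+ 2) * S N = 1 - (t ^+ 2) ^+ N.+1.
  by rewrite -opprB mulNr -subrX1 opprB.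
have S0 : 0 <= 2 * S N by rewrite mulr_ge0// sumr_ge0// => i _; rewrite !exprn_ge0// ltW.
have le4 := ler_wpM2r S0 tE.
have le5 : 2 * (rho - 1) * m * (t * (t ^+ 2) ^+ N) <= 2 * (rho - 1) * m * t ^+ N.
  rewrite ler_wpM2l// -exprM -exprS ler_wiXn2l//; try lra.
  by rewrite mul2n -addnn -addSn leq_addl.
have E : (rho - 1) * m * (t + t^-1) * (2 * S N) =
   2 * (rho - 1) * m * (t^-1 - t * (t ^+ 2) ^+ N + 2 * t * S N).
  have -> : t^-1 - t * (t ^+ 2) ^+ N = t^-1 * (1 - (t ^+ 2) ^+ N.+1).
    by rewrite [_ ^+ N.+1]exprS; field; lra.
  by rewrite -SE; field; lra.
lra.
Qed.

End Chain.

(** * Expanding operators and the mean of [A] with the adjoint of its inverse *)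

Section Operator.
Context {R : realType} {H : hilbertType R}.
Implicit Types (A B M : {linear H -> H}) (x y : H) (rho m t : R).

Definition unit_vector y : H := ((rnorm y)^-1)%:C%C *: y.

Lemma rnorm_unit_vector y : 0 < rnorm y -> rnorm (unit_vector y) = 1.
Proof.
move=> y0; have yV : 0 <= (rnorm y)^-1 by rewrite invr_ge0 ltW.
rewrite /unit_vector (rnormZ (c := (rnorm y)^-1)) ?ger0_norm ?ler0c//.
by rewrite mulVf// gt_eqF.
Qed.

Lemma rinner_unit_vector y : 0 < rnorm y -> rinner y (unit_vector y) = rnorm y.
Proof.
by move=> y0; rewrite rinnerZr -rnorm2 expr2 mulrA mulVf ?mul1r// gt_eqF.
Qed.

(* The orbit [.., M'^2 x, M' x, x, M x, M^2 x, ..], normalized, turns [M] into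
   a bilateral shift whose weights are at least 1. *)
Lemma expanding_bound rho m t M (M' : H -> H) x :
  1 <= rho <= 2 -> 0 < m -> 0 < t < 1 ->
  rho * m ^+ 2 - (2 - rho) <= (rho - 1) * m * (t + t^-1) ->
  form_bound rho m M -> adjoint_to M M' ->
  (forall y, rnorm y <= rnorm (M y)) -> (forall y, rnorm y <= rnorm (M' y)) ->
  rnorm x = 1 ->
  2 * (rho - 1) * m * rnorm (M x) + (2 - rho) * (rnorm (M x) ^+ 2 - 1)
    <= 2 * (rho - 1) * m * t^-1.
Proof.
move=> rho12 m0 t01 tE bM MM' eM eM' x1.
pose h n := iter n (fun y => unit_vector (M y)) x.
pose g n := iter n (fun y => unit_vector (M' y)) x.
have h1 n : rnorm (h n) = 1.
  by elim: n => //= n IH; rewrite rnorm_unit_vector// (lt_le_trans _ (eM _))// IH.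
have g1 n : rnorm (g n) = 1.
  by elim: n => //= n IH; rewrite rnorm_unit_vector// (lt_le_trans _ (eM' _))// IH.
have Mh n : 1 <= rnorm (M (h n)) by rewrite -[leLHS](h1 n).
have M'g n : 1 <= rnorm (M' (g n)) by rewrite -[leLHS](g1 n).
apply: (chain_bound rho12 m0 t01 bM tE (g := g) (h := h)) => //.
- by move=> n; rewrite -[leLHS](g1 n).
- move=> n; rewrite /rinner MM' -/(rinner _ _) rinnerC rinner_unit_vector//.
  by rewrite (lt_le_trans ltr01).
- by move=> n; rewrite rinner_unit_vector// (lt_le_trans ltr01).
- by rewrite rinner_unit_vector// (lt_le_trans ltr01 (Mh 0%N)).
Qed.

Definition mean_op A B : {linear H -> H} := (2^-1 : R)%:C%C \*: (A \+ B).

(** By the parallelogram law the mean has squared norm equal to the mean of the squares minus a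
    square, which [2 - rho >= 0] allows to drop. *)
Lemma form_bound_mean rho m A B : rho <= 2 ->
  form_bound rho m A -> form_bound rho m B -> form_bound rho m (mean_op A B).
Proof.
move=> rho2 bA bB zeta x z1; have := bA _ x z1; have := bB _ x z1 => /=.
have -> : zeta *: ((2^-1 : R)%:C%C *: (A x + B x)) =
    (2^-1 : R)%:C%C *: (zeta *: A x + zeta *: B x).
  by rewrite -scalerDr !scalerA mulrC.
rewrite rinnerZl rinnerDl.
have -> : rnorm ((2^-1 : R)%:C%C *: (A x + B x)) ^+ 2 =
    (2^-1 * (rnorm (A x) ^+ 2 + rnorm (B x) ^+ 2))
    - rnorm ((2^-1 : R)%:C%C *: (A x - B x)) ^+ 2.
  rewrite !rnorm2 !(rinnerZl, rinnerZr, rinnerDl, rinnerDr, rinnerNl, rinnerNr).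
  by field.
set d := rnorm (_ *: _); have : 0 <= (2 - rho) * d ^+ 2.
  by rewrite mulr_ge0 ?sqr_ge0// subr_ge0.
by move: (rinner _ _) (rinner _ _) => a b; lra.
Qed.

Lemma rnorm_mean A B x : 4 * rnorm (mean_op A B x) ^+ 2 =
  rnorm (A x) ^+ 2 + rnorm (B x) ^+ 2 + 2 * rinner (A x) (B x).
Proof.
rewrite !rnorm2 !(rinnerZl, rinnerZr, rinnerDl, rinnerDr) (rinnerC (B x)).
by field.
Qed.

Lemma rinner_inverse A B (B' : H -> H) x : cancel A B -> adjoint_to B B' ->
  rinner (A x) (B' x) = rnorm x ^+ 2.
Proof. by move=> AB BB'; rewrite rnorm2 /rinner -BB' AB. Qed.

(** Polarization: [4 |M x|^2 = |A x - B x|^2 + 4 Re <A x, B x>] for the mean [M]. *)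
Lemma mean_expanding A B x : rinner (A x) (B x) = rnorm x ^+ 2 ->
  rnorm x <= rnorm (mean_op A B x).
Proof.
move=> AB; rewrite -(@ler_pXn2r _ 2) ?nnegrE ?rnorm_ge0//.
rewrite -(@ler_pM2l _ 4)// rnorm_mean AB.
have : 0 <= rnorm (A x - B x) ^+ 2 by rewrite sqr_ge0.
rewrite rnorm2 !(rinnerDl, rinnerDr, rinnerNl, rinnerNr) (rinnerC (B x)) AB -!rnorm2.
lra.
Qed.

Lemma adjoint_mean A B A' B' : adjoint_to A A' -> adjoint_to B B' ->
  adjoint_to (mean_op A B) (mean_op A' B').
Proof.
move=> AA' BB' x y /=.
by rewrite innerZl innerZr innerDl innerDr AA' BB' conjc_real.
Qed.

Lemma invertible_bound rho m t A B A' B' x :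
  1 <= rho <= 2 -> 1 <= m -> 0 < t < 1 ->
  rho * m ^+ 2 - (2 - rho) <= (rho - 1) * m * (t + t^-1) ->
  cancel A B -> cancel B A -> adjoint_to A A' -> adjoint_to B B' ->
  form_bound rho m A -> form_bound rho m B ->
  form_bound rho m A' -> form_bound rho m B' -> rnorm x = 1 ->
  rnorm (A x) ^+ 2 + 1 <= 2 * rnorm (A x) * (1 + (rho - 1) * m * (t^-1 - 1)).
Proof.
move=> rho12 m1 t01 tE AB BA AA' BB' bA bB bA' bB' x1.
have [rho1 rho2] := andP rho12; have [t0 t1] := andP t01.
have m0 : 0 < m by lra.
pose M := mean_op A B'.
have AB'x y : rinner (A y) (B' y) = rnorm y ^+ 2 by exact: rinner_inverse AB BB'.
have A'Bx y : rinner (A' y) (B y) = rnorm y ^+ 2.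
  by rewrite rinnerC; exact: rinner_inverse BA AA'.
have := @expanding_bound rho m t M (mean_op A' B) x rho12 m0 t01 tE
  (form_bound_mean rho2 bA bB') (adjoint_mean AA' (adjoint_sym BB'))
  (fun y => mean_expanding (AB'x y)) (fun y => mean_expanding (A'Bx y)) x1.
have : 1 <= rnorm (M x) by rewrite -[leLHS]x1; exact: mean_expanding.
have : 4 * rnorm (M x) ^+ 2 = rnorm (A x) ^+ 2 + rnorm (B' x) ^+ 2 + 2.
  by rewrite rnorm_mean AB'x x1 expr1n mulr1.
have : 1 <= rnorm (A x) * rnorm (B' x).
  by rewrite -[leLHS](expr1n _ 2) -{1}x1 -AB'x rinner_le.
have := rnorm_ge0 (A x); have := rnorm_ge0 (B' x).
move: (rnorm (A x)) (rnorm (B' x)) (rnorm (M x)) => a b mu b0 a0 ab muE mu1 Mb.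
have a_gt0 : 0 < a.
  rewrite lt_neqAle a0 andbT.
  by apply: contraTneq ab => <-; rewrite mul0r ler10.
(* With [mu ^+ 2 - 1 = 2 (mu - 1) + (mu - 1) ^+ 2], the shift bound has coefficient
   [2 ((rho - 1) m + 2 - rho) >= 2] at [mu - 1]. *)
have mu_le : mu <= 1 + (rho - 1) * m * (t^-1 - 1).
  have k1 : 1 <= (rho - 1) * m + (2 - rho).
    have : 0 <= (rho - 1) * (m - 1) by rewrite mulr_ge0 ?subr_ge0.
    lra.
  have : 0 <= (2 - rho) * (mu - 1) ^+ 2 by rewrite mulr_ge0 ?sqr_ge0 ?subr_ge0.
  have : 0 <= (mu - 1) * ((rho - 1) * m + (2 - rho) - 1) by rewrite mulr_ge0 ?subr_ge0.
  lra.
(* Squared, [a ^+ 2 + 1 <= 2 a mu] reads [(a ^+ 2 + 1) ^+ 2 <= a ^+ 2 (a ^+ 2 + b ^+ 2 + 2)], which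
   follows from [a b >= 1]. *)
apply: (@le_trans _ _ (2 * a * mu)); last by rewrite ler_pM2l// mulr_gt0.
rewrite -(@ler_pXn2r _ 2 isT) ?nnegrE; last 2 first.
- by rewrite addr_ge0// sqr_ge0.
- by rewrite !mulr_ge0//; lra.
have -> : (2 * a * mu) ^+ 2 = a ^+ 2 * (4 * mu ^+ 2) by ring.
have : 1 <= (a * b) ^+ 2 by rewrite expr_ge1// mulr_ge0.
rewrite muE; lra.
Qed.

Lemma contraction_bound m A x : 0 < m -> form_bound 1 m A ->
  rnorm (A x) <= m * rnorm x.
Proof.
move=> m0 /(_ 1 x (normr1 _)); rewrite subrr mulr0 !mul0r add0r.
have -> : 2 - 1 = 1 :> R by ring.
rewrite !mul1r -exprMn ler_pXn2r// nnegrE ?rnorm_ge0// mulr_ge0 ?rnorm_ge0//.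
exact: ltW.
Qed.

End Operator.

(** * Scalar estimates in the fourth root of the perturbation *)

Section Asymptotics.
Context {R : realType}.

(** Here [d = rho - 1], [t = 1 - tau] and [d tau ^+ 2 = 2 s ^+ 4]. Since [t + t^-1 >= 2 + tau ^+ 2],
    the terms of order up to [s ^+ 4] match and [(1 - d) s ^+ 8 >= 0] remains. *)
Lemma weight_choice (d a s : R) : 0 < d <= 1 -> 0 < a -> a ^+ 4 = 8 * d ->
  0 < s -> 4 * s ^+ 2 / a ^+ 2 < 1 ->
  (1 + d) * (1 + s ^+ 4) ^+ 2 - (2 - (1 + d)) <=
    (1 + d - 1) * (1 + s ^+ 4) *
      (1 - 4 * s ^+ 2 / a ^+ 2 + (1 - 4 * s ^+ 2 / a ^+ 2)^-1).
Proof.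
move=> /andP[d0 d1] a0 a4 s0; set tau := 4 * s ^+ 2 / a ^+ 2 => tau1.
have tau_sq : d * tau ^+ 2 = 2 * s ^+ 4.
  have -> : d = a ^+ 4 / 8 by rewrite a4; field.
  by rewrite /tau; field; rewrite gt_eqF.
set n := s ^+ 4 in tau_sq *.
have n0 : 0 <= n by rewrite exprn_ge0// ltW.
have tV : 1 + tau + tau ^+ 2 <= (1 - tau)^-1.
  have t0 : 0 < 1 - tau by lra.
  have tau0 : 0 <= tau by rewrite divr_ge0 ?sqr_ge0// mulr_ge0// sqr_ge0.
  rewrite -(ler_pM2r t0) mulVf ?gt_eqF//.
  have -> : (1 + tau + tau ^+ 2) * (1 - tau) = 1 - tau ^+ 3 by ring.
  by rewrite gerBl exprn_ge0.
have k0 : 0 <= d * (1 + n) by rewrite mulr_ge0//; lra.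
have := ler_wpM2l k0 tV.
have -> : d * (1 + n) * (1 + tau + tau ^+ 2) =
   d * (1 + n) * (1 + tau) + (1 + n) * (2 * n) by rewrite -tau_sq; ring.
have : 0 <= (1 - d) * n ^+ 2 by rewrite mulr_ge0 ?sqr_ge0 ?subr_ge0.
move: (_^-1) => tt; lra.
Qed.

(** The leading factor is [d tau = a ^+ 2 s ^+ 2 / 2]; the rest uses [(1 - tau)^-1 <= 1 + 2 tau] for
    [tau <= 1/2]. *)
Lemma weight_defect (d a s : R) : 0 < d <= 1 -> 0 < a -> a ^+ 4 = 8 * d ->
  0 < s <= 1 -> 4 * s ^+ 2 / a ^+ 2 <= 2^-1 ->
  d * (1 + s ^+ 4) * ((1 - 4 * s ^+ 2 / a ^+ 2)^-1 - 1) <=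
    a ^+ 2 * s ^+ 2 / 2 * (1 + (1 + 16 / a ^+ 2) * s ^+ 2).
Proof.
move=> /andP[d0 d1] a0 a4 /andP[s0 s1]; set tau := 4 * s ^+ 2 / a ^+ 2 => tau1.
have tau0 : 0 <= tau by rewrite divr_ge0 ?sqr_ge0// mulr_ge0// sqr_ge0.
have dtau : d * tau = a ^+ 2 * s ^+ 2 / 2.
  have -> : d = a ^+ 4 / 8 by rewrite a4; field.
  by rewrite /tau; field; rewrite gt_eqF.
have t0 : 0 < 1 - tau by lra.
have -> : d * (1 + s ^+ 4) * ((1 - tau)^-1 - 1) =
    d * tau * ((1 + s ^+ 4) * (1 - tau)^-1) by field; rewrite gt_eqF.
rewrite dtau; apply: ler_wpM2l.
  by rewrite divr_ge0// mulr_ge0// sqr_ge0.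
have tV : (1 - tau)^-1 <= 1 + 2 * tau.
  rewrite -(ler_pM2r t0) mulVf ?gt_eqF//.
  have : 0 <= tau * (1 - 2 * tau) by rewrite mulr_ge0//; lra.
  lra.
have s4 : s ^+ 4 <= s ^+ 2 by rewrite ler_wiXn2l// ltW.
have s2 : s ^+ 2 <= 1 by rewrite exprn_ile1// ltW.
have s20 : 0 <= s ^+ 2 by rewrite sqr_ge0.
apply: (@le_trans _ _ ((1 + s ^+ 2) * (1 + 2 * tau))).
  apply: ler_pM => //; last by rewrite lerD2l.
    by rewrite addr_ge0// exprn_ge0// ltW.
  by rewrite invr_ge0 ltW.
have -> : (1 + 16 / a ^+ 2) * s ^+ 2 = s ^+ 2 + 4 * tau.
  by rewrite /tau; field; rewrite gt_eqF.
have : 0 <= tau * (1 - s ^+ 2) by rewrite mulr_ge0// subr_ge0.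
lra.
Qed.

(** The hypothesis on [y] says [(y - 1) ^+ 2 <= 2 delta y], so [y - 1] is about [a s]. [C] is chosen
    so that the cross term of [(a s + C s ^+ 2) ^+ 2] absorbs all corrections. *)
Lemma quadratic_root_bound (a K s y delta : R) (C := a * (2 * a + K * (1 + 2 * a))) :
  0 < a -> 0 < K -> 0 < s <= 1 -> C * s <= a ->
  delta <= a ^+ 2 * s ^+ 2 / 2 * (1 + K * s ^+ 2) ->
  y ^+ 2 + 1 <= 2 * y * (1 + delta) -> 0 <= y ->
  y <= 1 + a * s + C * s ^+ 2.
Proof.
move=> a0 K0 /andP[s0 s1] Cs dle yle y0.
rewrite leNgt; apply/negP => yD.
have s2_gt0 : 0 < s ^+ 2 by rewrite exprn_gt0.
have a2_gt0 : 0 < a ^+ 2 by rewrite exprn_gt0.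
have C0 : 0 < C by rewrite /C mulr_gt0// addr_gt0// mulr_gt0//; lra.
set D := a * s + C * s ^+ 2.
have D0 : 0 < D by rewrite addr_gt0// mulr_gt0.
set e := a ^+ 2 * s ^+ 2 * (1 + K * s ^+ 2).
have e0 : 0 < e by rewrite mulr_gt0 ?(mulr_gt0 a2_gt0)// addr_gt0// mulr_gt0.
have D2 : D <= 2 * a * s.
  have := ler_wpM2r (ltW s0) Cs; rewrite /D; lra.
have key : e * (1 + D) < D ^+ 2.
  have le1 : 1 + D <= 1 + 2 * a.
    have : a * s <= a by rewrite ler_piMr// ltW.
    lra.
  have as2 : 0 < a ^+ 2 * s ^+ 2 by rewrite mulr_gt0.
  have h1 : K * s ^+ 2 * (1 + D) <= K * s * (1 + 2 * a).
    apply: ler_pM => //; first by rewrite mulr_ge0// ltW.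
      by lra.
    by rewrite ler_pM2l// -[leRHS]expr1 ler_wiXn2l// ltW.
  have h2 : D + K * s ^+ 2 * (1 + D) <= s * (2 * a + K * (1 + 2 * a)) by lra.
  have := ler_wpM2l (ltW as2) h2.
  have -> : a ^+ 2 * s ^+ 2 * (s * (2 * a + K * (1 + 2 * a))) = a * s * (C * s ^+ 2).
    by rewrite /C; ring.
  have : 0 < a * s * (C * s ^+ 2) by rewrite mulr_gt0// mulr_gt0.
  have : 0 < (C * s ^+ 2) ^+ 2 by rewrite exprn_gt0// mulr_gt0.
  have -> : D ^+ 2 = (a * s) ^+ 2 + 2 * (a * s * (C * s ^+ 2)) + (C * s ^+ 2) ^+ 2.
    by rewrite /D; ring.
  rewrite /e; lra.
have De : e < D.
  rewrite -(ltr_pM2r D0) -expr2; apply: le_lt_trans key.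
  by rewrite ler_pM2l//; lra.
have {}dle : 2 * delta <= e by rewrite /e; lra.
have := ler_wpM2l y0 dle.
(* The product equals [(y - 1) ^+ 2 - e y + (e (1 + D) - D ^+ 2)], so [key] forces
   [(y - 1) ^+ 2 > e y], against the hypothesis. *)
have : 0 < (y - 1 - D) * (y - 1 + D - e) by rewrite mulr_gt0//; rewrite /D in De *; lra.
lra.
Qed.

(** The form bound requires a scale strictly above [1 + eps], so estimates come at [u > s];
    continuity then gives [s] itself. *)
Lemma le_of_forall_gt (a C s s0 y : R) : 0 <= a -> 0 <= C -> 0 <= s -> s < s0 ->
  s0 <= 1 -> (forall u, s < u <= s0 -> y <= 1 + a * u + C * u ^+ 2) ->
  y <= 1 + a * s + C * s ^+ 2.
Proof.
move=> a0 C0 s_ge0 ss0 s01 yle; apply/ler_addgt0Pr => e e0.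
(* On [[0, 1]] the map [u |-> a u + C u ^+ 2] has Lipschitz constant [a + 2 C]; adding 1 makes [B]
   positive. *)
pose B := a + 2 * C + 1.
have B0 : 0 < B by rewrite /B; lra.
pose u := Num.min s0 (s + e / B).
have eB : 0 < e / B by rewrite divr_gt0.
have us : s < u by rewrite lt_min ss0 ltrDl.
have uu : u <= s0 by rewrite ge_min lexx.
have us' : u - s <= e / B by rewrite lerBlDl ge_min lexx orbT.
have := yle u; rewrite us uu => /(_ isT) /le_trans; apply.
have : C * ((u - s) * (u + s)) <= C * ((u - s) * 2).
  by rewrite ler_wpM2l// ler_wpM2l//; lra.
have : B * (u - s) <= e by rewrite mulrC -ler_pdivlMr.
rewrite /B; have : 0 < u - s by lra.
lra.
Qed.

End Asymptotics.

(** * Reduction to unit vectors, and choice of the constants *)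

Lemma opnorm_le (R : realType) (H : hilbertType R) (A : {linear H -> H}) (c : R) :
  0 <= c -> (forall x, rnorm x = 1 -> rnorm (A x) <= c) -> (opnorm A <= c%:E)%E.
Proof.
move=> c0 Ac; apply: ge_ereal_sup => _ [x /= x1 <-]; rewrite lee_fin -/(rnorm _).
have {}x1 : rnorm x <= 1 by rewrite -lecR -rnormE.
have [->|x0] := eqVneq x 0; first by rewrite linear0 rnorm0.
have xgt0 : 0 < rnorm x by rewrite lt_neqAle rnorm_ge0 eq_sym rnorm_eq0 x0.
have := Ac _ (rnorm_unit_vector xgt0); rewrite linearZ.
have xV : 0 <= (rnorm x)^-1 by rewrite invr_ge0 ltW.
rewrite (rnormZ (c := (rnorm x)^-1)) ?ger0_norm ?ler0c//.
rewrite mulrC ler_pdivrMr// => /le_trans; apply.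
by rewrite ler_piMr.
Qed.

Lemma psi_le (R : realType) (rho r c : R) : 0 <= c ->
  (forall (H : hilbertType R) (A B : {linear H -> H}) x,
     cancel A B -> cancel B A -> (rho_radius rho A <= r%:E)%E ->
     (rho_radius rho B <= r%:E)%E -> rnorm x = 1 -> rnorm (A x) <= c) ->
  (psi rho r <= c%:E)%E.
Proof.
move=> c0 Hc; apply: ge_ereal_sup => _ [H [A [B [_ _ [AB BA] [wA wB] ->]]]].
by apply: opnorm_le => // x; apply: Hc.
Qed.

Lemma psi1_le (R : realType) (eps : R) : 0 <= eps <= 1 ->
  (psi 1 (1 + eps) <= (1 + (8 * (1 - 1) * eps) `^ 4^-1 + 1 * eps `^ 2^-1)%:E)%E.
Proof.
move=> /andP[e0 e1]; rewrite subrr mulr0 mul0r mul1r powR0 ?invr_eq0// addr0.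
set s := eps `^ 2^-1; have s0 : 0 <= s by exact: powR_ge0.
have s2 : s ^+ 2 = eps by rewrite -powR_mulrn// -powRrM mulVf// powRr1.
have es : eps <= s.
  have s1 : s <= 1 by rewrite -(@expr_le1 _ 2)// s2.
  by rewrite -s2 -[leRHS]expr1 ler_wiXn2l.
apply: psi_le => [|H A B x AB BA wA _ x1]; first by rewrite addr_ge0.
apply/ler_addgt0Pr => d d0.
have em : 1 + eps < 1 + eps + d by rewrite ltrDl.
have m0 : 0 < 1 + eps + d by lra.
have [_ [_ bA _]] := rho_radius_form_bound ltr01 em wA.
by have := contraction_bound x m0 bA; rewrite x1 mulr1; lra.
Qed.

Theorem corollary1p5 (R : realType) (rho : R) (hrho : 1 <= rho <= 2) :
  exists C eps0 : R,
    [/\ 0 < C, 0 < eps0 &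
        forall eps : R, 0 <= eps <= eps0 ->
          (psi rho (1 + eps) <=
             (1 + (8 * (rho - 1) * eps) `^ (4^-1)
                + C * eps `^ (2^-1))%:E)%E].
Proof.
(* For [rho = 1] the coefficient [a] below would vanish, and [tau = 4 u ^+ 2 / a ^+ 2] would make no
   sense. *)
have [<-|rho1] := eqVneq 1 rho.
  by exists 1, 1; split => // eps; exact: psi1_le.
have [rho_ge1 rho_le2] := andP hrho.
have d0 : 0 < rho - 1 by rewrite subr_gt0 lt_neqAle rho1.
have d01 : 0 < rho - 1 <= 1 by rewrite d0; lra.
set a := (8 * (rho - 1)) `^ 4^-1.
have a0 : 0 < a by rewrite powR_gt0// mulr_gt0.
have a4 : a ^+ 4 = 8 * (rho - 1).
  by rewrite -powR_mulrn ?powR_ge0// -powRrM mulVf// powRr1// mulr_ge0// ltW.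
set K := 1 + 16 / a ^+ 2.
have K0 : 0 < K by rewrite addr_gt0// divr_gt0// exprn_gt0.
set C := a * (2 * a + K * (1 + 2 * a)).
have C0 : 0 < C by rewrite mulr_gt0// addr_gt0 ?mulr_gt0//; lra.
(* The three bounds ensure [u <= 1], [C u <= a] and [tau <= 4/9 < 1/2]. *)
pose s0 := Num.min 1 (Num.min (a / C) (a / 3)).
have s0_gt0 : 0 < s0 by rewrite !lt_min ltr01 !divr_gt0.
have s0_le1 : s0 <= 1 by rewrite ge_min lexx.
have s0C : s0 <= a / C by rewrite !ge_min lexx orbT.
have s0a : s0 <= a / 3 by rewrite !ge_min lexx !orbT.
(* Halving [s0] keeps [s] strictly below [s0], leaving room for [u] between them. *)
exists C, ((s0 / 2) ^+ 4); split => //; first by rewrite exprn_gt0 ?divr_gt0.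
move=> eps /andP[eps0 eps_le].
set s := eps `^ 4^-1; have s_ge0 : 0 <= s by exact: powR_ge0.
have s4 : s ^+ 4 = eps by rewrite -powR_mulrn// -powRrM mulVf// powRr1.
have ss0 : s < s0.
  have : s <= s0 / 2 by rewrite -(@ler_pXn2r _ 4) ?nnegrE// ?s4//; lra.
  lra.
have -> : (8 * (rho - 1) * eps) `^ 4^-1 = a * s by rewrite powRM// mulr_ge0// ltW.
have -> : eps `^ 2^-1 = s ^+ 2.
  by rewrite -powR_mulrn// -powRrM; congr (_ `^ _); field.
apply: psi_le => [|H A B x AB BA wA wB x1].
  by rewrite addr_ge0 ?addr_ge0// mulr_ge0 ?sqr_ge0// ltW.
apply: (le_of_forall_gt (ltW a0) (ltW C0) s_ge0 ss0 s0_le1) => u /andP[su us0].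
have u0 : 0 < u by exact: le_lt_trans su.
have u01 : 0 < u <= 1 by rewrite u0 (le_trans us0).
have Cu : C * u <= a.
  by rewrite mulrC -ler_pdivlMr// (le_trans us0).
have tau_le : 4 * u ^+ 2 / a ^+ 2 <= 2^-1.
  rewrite ler_pdivrMr ?exprn_gt0//.
  have ua : 3 * u <= a by rewrite mulrC -ler_pdivlMr// (le_trans us0).
  have : (3 * u) ^+ 2 <= a ^+ 2 by rewrite ler_pXn2r// nnegrE; lra.
  have : 0 <= u ^+ 2 by rewrite sqr_ge0.
  lra.
have em : 1 + eps < 1 + u ^+ 4 by rewrite ltrD2l -s4 ltr_pXn2r// nnegrE ltW.
have rho0 : 0 < rho by lra.
have [A' [AA' bA bA']] := rho_radius_form_bound rho0 em wA.
have [B' [BB' bB bB']] := rho_radius_form_bound rho0 em wB.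
have t01 : 0 < 1 - 4 * u ^+ 2 / a ^+ 2 < 1.
  have : 0 < 4 * u ^+ 2 / a ^+ 2 by rewrite divr_gt0 ?mulr_gt0 ?exprn_gt0.
  move: (_ / _) tau_le => tau tau_le tau0; lra.
have tau_lt1 : 4 * u ^+ 2 / a ^+ 2 < 1 by apply: le_lt_trans tau_le _; lra.
have m1 : 1 <= 1 + u ^+ 4 by rewrite lerDl exprn_ge0// ltW.
have tE := weight_choice d01 a0 a4 u0 tau_lt1; rewrite (addrC 1 (rho - 1)) subrK in tE.
have := invertible_bound hrho m1 t01 tE AB BA AA' BB' bA bB bA' bB' x1.
have := weight_defect d01 a0 a4 u01 tau_le.
move=> dle yle; apply: quadratic_root_bound dle yle _ => //; exact: rnorm_ge0.
Qed.
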